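(* For every positive integer $n$, $$R_n^{D}(t)-R_n^{B-D}(t)=\begin{cases}2t(1-t)(1-t^2)^{k-1}& n=2k,\\ 0& n\text{ odd}.\end{cases}$$
   Context: $\mathfrak{B}_n$ is the group of signed permutations in window notation $\pi=\pi_1\cdots\pi_n$, and $\mathfrak{D}_n\subseteq\mathfrak{B}_n$ the subset with an even number of negative entries. Set $\pi_0=0$; for $\pi\in\mathfrak{B}_n$ let $\mathrm{pk}_B(\pi)$ (resp. $\mathrm{val}_B(\pi)$) be the number of $i\in\{1,\dots,n-1\}$ with $\pi_{i-1}<\pi_i>\pi_{i+1}$ (resp. $\pi_{i-1}>\pi_i<\pi_{i+1}$), and $\mathrm{altruns}_B(\pi)=\mathrm{pk}_B(\pi)+\mathrm{val}_B(\pi)+1$. Define $R_n^D(t)=\sum_{\pi\in\mathfrak{D}_n}t^{\mathrm{altruns}_B(\pi)}$ and $R_n^{B-D}(t)=\sum_{\pi\in\mathfrak{B}_n\setminus\mathfrak{D}_n}t^{\mathrm{altruns}_B(\pi)}$. *)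

(* Defs.v *)
From mathcomp Require Import all_boot all_order all_fingroup all_algebra.

Set Implicit Arguments.
Unset Strict Implicit.
Unset Printing Implicit Defensive.

Import Order.TTheory GRing.Theory Num.Theory.
Local Open Scope ring_scope.

(* A signed permutation is encoded by the permutation of absolute values of its
   window and the positions of its negative entries ([true] = negative).  The
   indices 'I_n start at 0, whereas the window is a signed rearrangement of
   1, ..., n; see [windowP] for the correspondence. *)
Notation signed_perm n := ('S_n * {ffun 'I_n -> bool})%type.

Definition window n (p : signed_perm n) (i : 'I_n) : int :=
  (-1) ^+ p.2 i * (p.1 i).+1%:Z.

Lemma abs_window n (p : signed_perm n) i : `|window p i|%N = (p.1 i).+1.
Proof. by rewrite /window abszMsign absz_nat. Qed.

Lemma window_lt0 n (p : signed_perm n) i : (window p i < 0) = p.2 i.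
Proof.
by rewrite /window; case: (p.2 i); rewrite ?expr1 ?mulN1r ?expr0 ?mul1r.
Qed.

Lemma windowP n (w : 'I_n -> int) :
  (forall i, 1 <= `|w i| <= n)%N -> injective (fun i => `|w i|%N) ->
  exists! p : signed_perm n, window p =1 w.
Proof.
move=> w_bnd w_inj.
have lt_n i : (`|w i|.-1 < n)%N.
  by case/andP: (w_bnd i); case: `|w i|%N.
have f_inj : injective (fun i => Ordinal (lt_n i)).
  move=> i j [] eq_ij; apply: w_inj => /=.
  case/andP: (w_bnd i) => wi _; case/andP: (w_bnd j) => wj _.
  by rewrite -(prednK wi) -(prednK wj) eq_ij.
exists (perm f_inj, [ffun i => w i < 0]); split=> [i | [s e] Dw].
  case/andP: (w_bnd i) => wi _.
  by rewrite /window /= permE ffunE /= prednK // -intEsign.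
congr (_, _).
  apply/permP=> i; apply: val_inj; rewrite permE /=.
  by rewrite -Dw abs_window.
by apply/ffunP=> i; rewrite ffunE -Dw window_lt0.
Qed.

(* [letter p i] is the i-th entry in 1-based numbering, with [letter p 0 = 0]. *)
Definition letter n (p : signed_perm n) (i : nat) : int :=
  nth 0 (0 :: [seq window p j | j : 'I_n]) i.

Lemma letterS n (p : signed_perm n) (j : 'I_n) : letter p j.+1 = window p j.
Proof. by rewrite /letter /= (nth_map j) ?size_enum_ord ?nth_ord_enum. Qed.

Definition pkB n (p : signed_perm n) : nat :=
  (\sum_(1 <= i < n)
     ((letter p i.-1 < letter p i) && (letter p i > letter p i.+1))%R)%N.

Definition valB n (p : signed_perm n) : nat :=
  (\sum_(1 <= i < n)
     ((letter p i.-1 > letter p i) && (letter p i < letter p i.+1))%R)%N.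

Definition altrunsB n (p : signed_perm n) : nat := (pkB p + valB p + 1)%N.

Definition typeD n : {set signed_perm n} :=
  [set p | ~~ odd #|[set i | window p i < 0]|].

Definition RD n : {poly int} := \sum_(p in typeD n) 'X^(altrunsB p).

Definition RBD n : {poly int} := \sum_(p in ~: typeD n) 'X^(altrunsB p).

(* Main.v *)
(* Comparing two entries only involves the sign of the one with the larger
   absolute value.  Hence flipping the sign of an entry that is smaller in
   absolute value than its neighbours keeps the number of alternating runs and
   exchanges D_n with its complement.  Such an entry exists unless the absolute
   values are increasing, so only the 2^n signings of the identity contribute.
   For these, consecutive signs contribute independently, and a transfer-matrix
   recursion of period two gives the formula. *)
Require Import Defs.
From mathcomp Require Import all_boot all_order all_fingroup all_algebra.
From mathcomp Require Import zify ring.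

Import GRing.Theory.
Local Open Scope ring_scope.

Lemma big_ffun_ord_recl (V : nmodType) (T : finType) n
    (F : {ffun 'I_n.+1 -> T} -> V) :
  \sum_f F f =
  \sum_x \sum_(g : {ffun 'I_n -> T}) F [ffun i => oapp g x (unlift ord0 i)].
Proof.
rewrite pair_bigA /=.
rewrite (reindex (fun u : T * {ffun 'I_n -> T} =>
  [ffun i => oapp u.2 u.1 (unlift ord0 i)])) //=.
exists (fun f : {ffun 'I_n.+1 -> T} => (f ord0, [ffun i => f (lift ord0 i)])).
  move=> [x g] _ /=; congr (_, _); first by rewrite ffunE unlift_none.
  by apply/ffunP=> i; rewrite !ffunE liftK.
move=> f _; apply/ffunP=> i; rewrite ffunE.
by case: unliftP => [j|] -> //=; rewrite ffunE.
Qed.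

Lemma codom_ffun_ord_recl (T : finType) n (x : T) (g : {ffun 'I_n -> T}) :
  codom [ffun i => oapp g x (unlift ord0 i)] = x :: codom g.
Proof.
rewrite /codom /image_mem enum_ordSl /= ffunE unlift_none /= -map_comp.
by congr (_ :: _); apply: eq_map => i /=; rewrite ffunE liftK.
Qed.

Lemma count_codom n (e : {ffun 'I_n -> bool}) :
  count id (codom e) = #|[set i | e i]|.
Proof. by rewrite -sum1dep_card -sum1_count big_image_cond. Qed.

(* [b] is the sign preceding the word [s]. *)
Definition sgn_weight (b : bool) (s : seq bool) : {poly int} :=
  (-1) ^+ count id s *
  'X^(\sum_(i < size s) (nth false (b :: s) i != nth false s i))%N.

Lemma sgn_weight_cons b x s :
  sgn_weight b (x :: s) = (-1) ^+ x * 'X^(b != x) * sgn_weight x s.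
Proof. by rewrite /sgn_weight /= big_ord_recl /= !exprD; ring. Qed.

Definition sgn_sum n b : {poly int} :=
  \sum_(g : {ffun 'I_n -> bool}) sgn_weight b (codom g).

Lemma sgn_sumS n b :
  sgn_sum n.+1 b = 'X^b * sgn_sum n false - 'X^(~~ b) * sgn_sum n true.
Proof.
rewrite /sgn_sum big_ffun_ord_recl big_bool /= addrC; congr (_ + _).
  rewrite mulr_sumr; apply: eq_bigr => g _.
  by rewrite codom_ffun_ord_recl sgn_weight_cons expr0 mul1r; case: b.
rewrite -mulNr mulr_sumr; apply: eq_bigr => g _.
by rewrite codom_ffun_ord_recl sgn_weight_cons expr1 mulN1r; case: b.
Qed.

(** The transfer matrix of [sgn_sumS] has rows [(1, -X)] and [(X, -1)]; its square is the scalar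
    matrix [1 - X^2], so each further pair of signs contributes that factor whatever precedes it. *)
Lemma sgn_sum_double k b : sgn_sum k.*2 b = (1 - 'X^2) ^+ k.
Proof.
elim: k b => [|k IHk] b.
  rewrite /sgn_sum (big_pred1 [ffun=> false]) => [|g].
    by rewrite /sgn_weight size_codom card_ord big_ord0 mulr1 count_codom
      (_ : [set _ | _] = set0) ?cards0 //; apply/setP => -[].
  by apply/esym/eqP/ffunP => -[].
rewrite doubleS !sgn_sumS !IHk [RHS]exprS; case: b; rewrite /= expr0 expr1; ring.
Qed.

Lemma sgn_sum_doubleS k b :
  sgn_sum k.*2.+1 b = ('X^b - 'X^(~~ b)) * (1 - 'X^2) ^+ k.
Proof. by rewrite sgn_sumS !sgn_sum_double mulrBl. Qed.

Lemma RD_sub_RBD n :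
  RD n - RBD n =
  \sum_(s : 'S_n) \sum_(e : {ffun 'I_n -> bool})
     (-1) ^+ #|[set i | e i]| * 'X^(altrunsB (s, e)).
Proof.
rewrite pair_bigA /= (bigID (mem (typeD n))) /= -sumrN; congr (_ + _).
  apply: eq_bigr => -[s e]; rewrite inE -signr_odd => /negPf.
  by under eq_finset do rewrite window_lt0; move=> /= ->; rewrite mul1r.
apply: eq_big => [p|[s e]]; rewrite !inE // negbK -signr_odd.
by under eq_finset do rewrite window_lt0; move=> /= ->; rewrite mulN1r.
Qed.

Lemma eq_altrunsB n (p q : signed_perm n) :
  (forall i, (i < n)%N ->
     ((letter p i < letter p i.+1) = (letter q i < letter q i.+1)) *
     ((letter p i > letter p i.+1) = (letter q i > letter q i.+1))) ->
  altrunsB p = altrunsB q.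
Proof.
move=> eq_pq; rewrite /altrunsB /pkB /valB.
by congr (_ + _ + _)%N; apply: eq_big_nat => -[|i] //= i_n;
  rewrite !eq_pq // ltnW.
Qed.

Definition flip n (j : 'I_n) (e : {ffun 'I_n -> bool}) :=
  [ffun i => (i == j) (+) e i].

Lemma flipK n (j : 'I_n) : involutive (flip n j).
Proof. by move=> e; apply/ffunP => i; rewrite !ffunE addKb. Qed.

Lemma sign_flip n (j : 'I_n) e :
  (-1) ^+ #|[set i | flip n j e i]| = - (-1) ^+ #|[set i | e i]| :> {poly int}.
Proof.
(* As a product over positions, the sign has a single factor that depends on the value at [j]. *)
have sgnE f : (-1) ^+ #|[set i | f i]| = \prod_(i < n) (-1) ^+ f i :> {poly int}.
  rewrite prodrXr -sum1dep_card big_mkcond /=.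
  by congr (_ ^+ _); apply: eq_bigr => i _; case: (f i).
rewrite !sgnE (bigD1 j) //= [in RHS](bigD1 j) //= ffunE eqxx signr_addb.
rewrite expr1 -!mulrA mulN1r; congr (- (_ * _)).
by apply: eq_bigr => i /negPf ij; rewrite ffunE ij.
Qed.

(* The first position is excluded, its left neighbour being the letter 0; the
   last one only has a left neighbour. *)
Definition local_min n (s : 'S_n) (j : 'I_n) :=
  ((exists2 i : 'I_n, i.+1 = j :> nat & (s j < s i)%N) /\
   (forall i : 'I_n, i = j.+1 :> nat -> (s j < s i)%N)).

(** The sign of [b] decides both comparisons; [a] and [c] will be an entry before and after its
    flip, [b] a neighbour. *)
Lemma ltz_abs (a b c : int) : (`|a| < `|b|)%N -> `|c|%N = `|a|%N ->
  ((a < b) = (c < b)) * ((b < a) = (b < c)).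
Proof. by move=> *; split; lia. Qed.

Lemma altrunsB_flip n (s : 'S_n) j e :
  local_min n s j -> altrunsB (s, flip n j e) = altrunsB (s, e).
Proof.
move=> [[i0 i0j s_i0] s_min].
have windowF i : i != j -> window (s, flip n j e) i = window (s, e) i.
  by move=> /negPf ij; rewrite /window /= ffunE ij.
(* The comparison of the letter 0 with the first entry is unaffected, since [j] has a left
   neighbour. Any other comparison has [j] on its left, on its right, or not at all. *)
apply: eq_altrunsB => -[|i] i_n; rewrite !(letterS _ (Ordinal i_n)).
  have ij: Ordinal i_n != j by rewrite -val_eqE /= -i0j.
  by rewrite windowF.
have i_n' := ltnW i_n.
rewrite !(letterS _ (Ordinal i_n')).
have [Dj|] := eqVneq (Ordinal i_n') j.
  have nj: Ordinal i_n != j by rewrite -Dj -val_eqE /=; lia.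
  have lt_s : (s j < s (Ordinal i_n))%N by apply: s_min; rewrite -Dj.
  rewrite (windowF _ nj) Dj.
  by have [||-> ->] := ltz_abs (window (s, flip n j e) j)
       (window (s, e) (Ordinal i_n)) (window (s, e) j); rewrite ?abs_window.
have [Dj nj|nj nj'] := eqVneq (Ordinal i_n) j; last by rewrite !windowF.
have Di : Ordinal i_n' = i0 by apply: val_inj => /=; move: i0j; rewrite -Dj => -[].
rewrite (windowF _ nj) Dj Di.
by have [||-> ->] := ltz_abs (window (s, flip n j e) j)
     (window (s, e) i0) (window (s, e) j); rewrite ?abs_window.
Qed.

(* The smallest entry that is preceded by a larger one is a local minimum. *)
Lemma exists_local_min n (s : 'S_n) : s != 1%g -> exists j, local_min n s j.
Proof.
move=> s_n1.
pose inv_right (j : 'I_n) := [exists i : 'I_n, (i < j)%N && (s j < s i)%N].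
have [j0 inv_j0] : exists j, inv_right j.
  have [i0 mv0] : exists i, s i != i.
    apply/existsP; apply: contraNT s_n1 => /existsPn fix_s.
    by apply/eqP/permP => i; rewrite perm1; apply/eqP; have:= fix_s i; rewrite negbK.
  (* All positions before the least moved point [i] are fixed, so [s i] exceeds [i] and the value
     [i] occurs further right, at [s^-1 i]. *)
  case: (@arg_minnP _ i0 (fun i => s i != i) (@nat_of_ord n) mv0) => i mv_i min_i.
  have fix_lt (k : 'I_n) : (k < i)%N -> s k = k.
    by move=> lt_ki; apply/eqP; apply: contraLR lt_ki => /min_i; rewrite -leqNgt.
  exists (s^-1 i)%g; apply/existsP; exists i; rewrite permKV.
  apply/andP; split; rewrite ltn_neqAle leqNgt; apply/andP; split.
  - by apply: contraNneq mv_i => /val_inj Di; rewrite {1}Di permKV.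
  - by apply: contraNN mv_i => /fix_lt; rewrite permKV => Di; rewrite {1}Di permKV.
  - by rewrite eq_sym.
  - by apply: contraNN mv_i => /fix_lt /perm_inj ->.
case: (@arg_minnP _ j0 inv_right (fun j => s j) inv_j0) => j /existsP[i /andP[ij si]] min_j.
exists j; split=> [|k Dk].
  have j1 : (j.-1 < n)%N by apply: leq_ltn_trans (ltn_ord j); apply: leq_pred.
  exists (Ordinal j1); first by rewrite /= prednK //; lia.
  rewrite ltnNge; apply/negP => le_s.
  (* A smaller left neighbour would itself be preceded by the larger [s i], against the minimality
     of [s j]; the same argument excludes a smaller right neighbour. *)
  have lt_s: (s (Ordinal j1) < s j)%N.
    rewrite ltn_neqAle le_s andbT; apply/eqP => /val_inj/perm_inj/(congr1 val) /=.
    by lia.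
  suff /min_j : inv_right (Ordinal j1) by rewrite leqNgt lt_s.
  apply/existsP; exists i; rewrite (ltn_trans lt_s si) andbT /=.
  have : i != Ordinal j1 by apply: contraTneq si => ->; rewrite -leqNgt.
  by rewrite -val_eqE /=; lia.
rewrite ltnNge; apply/negP => le_s.
have lt_s: (s k < s j)%N.
  rewrite ltn_neqAle le_s andbT; apply/eqP => /val_inj/perm_inj/(congr1 val) /=.
  by lia.
suff /min_j : inv_right k by rewrite leqNgt lt_s.
by apply/existsP; exists i; rewrite (ltn_trans lt_s si) andbT; lia.
Qed.

(** Flipping the sign at a local minimum is an involution that reverses the sign of every term, so
    the sum equals its own opposite. *)
Lemma sum_signs_eq0 n (s : 'S_n) : s != 1%g ->
  \sum_(e : {ffun 'I_n -> bool})
     (-1) ^+ #|[set i | e i]| * 'X^(altrunsB (s, e)) = 0 :> {poly int}.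
Proof.
case/exists_local_min => j min_j; set S := (X in X = 0).
have : S = - S.
  rewrite {1}/S (reindex_inj (inv_inj (flipK n j))) -sumrN.
  by apply: eq_bigr => e _; rewrite sign_flip altrunsB_flip // mulNr.
(* Vanishing is deduced from [S = - S] coefficientwise, over the integers. *)
move/polyP=> SN; apply/polyP => i; move: (SN i); rewrite coefN coef0.
by move: (S`_i : int) => c; lia.
Qed.

(** Over the identity, absolute values increase along the word, so the sign of the later letter
    decides each comparison. *)
Lemma ltz_letter1 n (e : {ffun 'I_n -> bool}) i : (i < n)%N ->
  ((letter (1%g, e) i < letter (1%g, e) i.+1) = ~~ nth false (codom e) i) *
  ((letter (1%g, e) i > letter (1%g, e) i.+1) = nth false (codom e) i).
Proof.
move=> i_n.
have -> : nth false (codom e) i = e (Ordinal i_n).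
  by rewrite (nth_map (Ordinal i_n)) ?size_enum_ord // (nth_ord_enum _ (Ordinal i_n)).
have -> : letter (1%g, e) i.+1 = (-1) ^+ e (Ordinal i_n) * i.+1%:Z.
  by rewrite (letterS _ (Ordinal i_n)) /window /= perm1.
have : (`|letter (1%g, e) i| <= i)%N.
  case: i i_n => // i i_n.
  by rewrite (letterS _ (Ordinal (ltnW i_n))) abs_window perm1.
by case: (e _); rewrite ?expr1 ?expr0 => le_i; split; lia.
Qed.

(** Ascents and descents being given by the signs, a letter is a peak or valley exactly when the
    next one has the opposite sign. *)
Lemma altrunsB1 n (e : {ffun 'I_n.+1 -> bool}) :
  altrunsB (1%g, e) =
  (\sum_(i < n) (nth false (codom e) i != nth false (codom e) i.+1)).+1.
Proof.
rewrite /altrunsB /pkB /valB -big_split addn1 big_add1 big_mkord; congr _.+1.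
apply: eq_bigr => i _ /=.
have [lt_i gt_i] := ltz_letter1 n.+1 e i (ltnW (ltn_ord i)).
have [lt_i1 gt_i1] := ltz_letter1 n.+1 e i.+1 (ltn_ord i).
rewrite lt_i gt_i lt_i1 gt_i1.
by do 2!case: nth.
Qed.

(** Only the identity survives. Its first sign is split off as the sign preceding the other [n]; the
    factor ['X] is the constant 1 in [altrunsB]. *)
Lemma RD_sub_RBD_signs n :
  RD n.+1 - RBD n.+1 = 'X * (sgn_sum n false - sgn_sum n true).
Proof.
rewrite RD_sub_RBD (bigD1 1%g) //= [X in _ + X]big1 => [|s]; last exact: sum_signs_eq0.
rewrite addr0 big_ffun_ord_recl big_bool /= addrC mulrBr; congr (_ + _).
  rewrite mulr_sumr; apply: eq_bigr => g _.
  rewrite -count_codom altrunsB1 codom_ffun_ord_recl /sgn_weight size_codom.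
  by rewrite card_ord exprS mulrCA.
rewrite -mulrN -sumrN mulr_sumr; apply: eq_bigr => g _.
rewrite -count_codom altrunsB1 codom_ffun_ord_recl /sgn_weight size_codom.
by rewrite card_ord !exprS /=; ring.
Qed.

Theorem theorem52 (n : nat) (hn : (0 < n)%N) :
  (forall k : nat, n = (2 * k)%N ->
     RD n - RBD n = 2%:R * 'X * (1 - 'X) * (1 - 'X^2) ^+ (k - 1)) /\
  (odd n -> RD n - RBD n = 0).
Proof.
split=> [[|k] Dn|n_odd]; first by rewrite Dn in hn.
  (* An odd number of signs follows the first, and [(1 - X) - (X - 1)] produces the factor 2. *)
  rewrite Dn mul2n doubleS RD_sub_RBD_signs !sgn_sum_doubleS subn1 /=; ring.
(* An even number of signs follows the first, so both sums are the same power of [1 - X^2] and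
   cancel. *)
rewrite -(odd_double_half n) n_odd RD_sub_RBD_signs !sgn_sum_double; ring.
Qed.
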